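(* Let $n\ge 2$ and let $\mathcal{G}=(V,\mathcal{E})$ be a sparsity pattern with $\alpha$-nodes $V_\alpha=\{\alpha_1,\ldots,\alpha_n\}$ such that: (i) there is only one single $\beta$-node, denoted $\beta$; (ii) the node $\alpha_1\in V_\alpha$ has a self-loop, and $(\beta,\alpha_1)$ is an edge of $\mathcal{G}$; (iii) the subgraph $\mathcal{G}_\alpha$ of $\mathcal{G}$ induced by $V_\alpha$ contains a directed spanning tree $\mathcal{T}_\alpha$ with root $\alpha_1$. For $k\ge 0$ let $V_\alpha(k)$ be the set of nodes of $V_\alpha$ of depth $k$ in $\mathcal{T}_\alpha$, let $p$ be the maximum depth, so that $V_\alpha=\bigcup_{k=0}^p V_\alpha(k)$ is a partition, and set $$\ell_j:=1+\sum_{k=1}^{j-1}|V_\alpha(k)|,\qquad j=1,\ldots,p.$$ Suppose in addition that (iv) the $n\times n$ matrix $H_n(\ell_1,\ldots,\ell_p)$ is invertible. Then $\mathcal{G}$ is structurally averaged controllable.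
   Context: Let $n,m$ be positive integers and $\Sigma=[0,1]$. Sparsity patterns. A sparsity pattern is a directed graph $\mathcal{G}=(V,\mathcal{E})$ (self-loops allowed) with node set $V=\{\alpha_1,\ldots,\alpha_n,\beta_1,\ldots,\beta_m\}$ such that no $\beta$-node has an incoming edge. $\mathbb{V}(\mathcal{G})$ denotes the vector space of all pairs $(A,B)\in \mathrm{C}^0(\Sigma,\mathbb{R}^{n\times n}\times\mathbb{R}^{n\times m})$ compliant with $\mathcal{G}$, meaning: the $(j,i)$ entry of $A$ is the zero function whenever $(\alpha_i,\alpha_j)\notin\mathcal{E}$, and the $(j,i)$ entry of $B$ is the zero function whenever $(\beta_i,\alpha_j)\notin\mathcal{E}$. Averaged controllability. Given continuous $A:\Sigma\to\mathbb{R}^{n\times n}$ and $B:\Sigma\to\mathbb{R}^{n\times m}$, consider the linear ensemble system $$\frac{\partial}{\partial t}x(t,\sigma)=A(\sigma)x(t,\sigma)+B(\sigma)u(t),\qquad \sigma\in\Sigma,\ t\ge 0, \tag{E}$$ with $x(t,\sigma)\in\mathbb{R}^n$ and a control input $u(t)\in\mathbb{R}^m$ that does not depend on $\sigma$. System (E) is averaged controllable if for any $x_0\in\mathbb{R}^n$ and any initial profile $x(0,\cdot)\in \mathrm{C}^0(\Sigma,\mathbb{R}^n)$ with $\int_0^1 x(0,\sigma)\,\mathrm{d}\sigma=x_0$, any target $x^*\in\mathbb{R}^n$, and any time $T>0$, there is $u\in \mathrm{L}^1([0,T];\mathbb{R}^m)$ such that $\int_0^1 x(T,\sigma)\,\mathrm{d}\sigma=x^*$.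 $\mathcal{G}$ is structurally averaged controllable if there is a pair $(A,B)\in\mathbb{V}(\mathcal{G})$ such that (E) is averaged controllable. Depth. For each $\alpha_i$ there is a unique path in $\mathcal{T}_\alpha$ from the root $\alpha_1$ to $\alpha_i$; the depth of $\alpha_i$ is the length (number of edges) of this path. In particular $V_\alpha(0)=\{\alpha_1\}$. Sparse Hilbert matrices. The Hilbert matrix $H_n$ is the $n\times n$ matrix with $(H_n)_{ij}=\frac{1}{i+j-1}$. For $\gamma\in\{1,\ldots,n\}$ and a non-decreasing sequence of positive integers $\ell_1,\ldots,\ell_\gamma$ with $i\le\ell_i<n$ for all $i$, the matrix $H_n(\ell_1,\ldots,\ell_\gamma)$ is obtained from $H_n$ by setting to zero, for each column $i\in\{1,\ldots,\gamma\}$, the entries of that column in rows larger than $\ell_i$. Equivalently, $H_n(\ell_1,\ldots,\ell_\gamma)=H_n-\sum_{i=1}^{\gamma}u^{(\ell_i)}e_i^\top$, where $e_i$ is the $i$th standard unit vector of $\mathbb{R}^n$ and $u^{(\ell_i)}\in\mathbb{R}^n$ has components $u^{(\ell_i)}_j=0$ for $j\le\ell_i$ and $u^{(\ell_i)}_j=\frac{1}{i+j-1}$ for $j>\ell_i$. *)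

(* Defs.v *)
From HB Require Import structures.
From mathcomp Require Import all_boot all_order all_algebra.
From mathcomp Require Import all_classical all_reals all_analysis.

Set Implicit Arguments.
Unset Strict Implicit.
Unset Printing Implicit Defensive.

Import Order.TTheory GRing.Theory Num.Theory.
Import numFieldNormedType.Exports.

Local Open Scope classical_set_scope.
Local Open Scope ring_scope.

(* [inl i] is the node alpha_{i+1} and [inr j] is the node beta_{j+1}. *)
Record sparsity_pattern (n m : nat) := SparsityPattern {
  edge :> rel ('I_n + 'I_m)%type;
  edge_beta : forall (v : 'I_n + 'I_m) (j : 'I_m), ~~ edge v (inr j)
}.

Definition alpha_graph (n m : nat) (G : sparsity_pattern n m) : rel 'I_n :=
  fun i j => G (inl i) (inl j).

Definition continuous_on {R : realType} {T : topologicalType}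
    (a b : R) (f : R -> T) : Prop :=
  {within `[a, b], continuous f}.

(* Functions on [0, 1] are represented by functions on R whose values outside
   of [0, 1] are irrelevant. *)
Definition compliant {R : realType} (n m : nat) (G : sparsity_pattern n m)
    (A : R -> 'M[R]_n) (B : R -> 'M[R]_(n, m)) : Prop :=
  [/\ continuous_on 0 1 A,
      continuous_on 0 1 B,
      forall i j : 'I_n, ~~ G (inl i) (inl j) ->
        forall s : R, s \in `[0, 1] -> A s j i = 0
    & forall (i : 'I_m) (j : 'I_n), ~~ G (inr i) (inl j) ->
        forall s : R, s \in `[0, 1] -> B s j i = 0].

Definition vintegral {R : realType} (n : nat) (a b : R) (f : R -> 'cV[R]_n) :
    'cV[R]_n :=
  \col_i \int[lebesgue_measure]_(s in `[a, b]) f s i 0.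

Definition L1_control {R : realType} (m : nat) (T : R) (u : R -> 'cV[R]_m) :
    Prop :=
  forall i, lebesgue_measure.-integrable `[0, T] (EFin \o (fun t => u t i 0)).

(* Since the control is only L^1, the ODE is understood in the sense of
   Caratheodory, i.e. as the integral equation
     x(t, s) = x0(s) + \int_0^t (A(s) x(r, s) + B(s) u(r)) dr.
   The state x(t, .) lives in C^0([0, 1], R^n); x(., s) is continuous, so that
   the integrand is integrable. *)
Definition ensemble_solution {R : realType} (n m : nat)
    (A : R -> 'M[R]_n) (B : R -> 'M[R]_(n, m)) (T : R)
    (x0 : R -> 'cV[R]_n) (u : R -> 'cV[R]_m) (x : R -> R -> 'cV[R]_n) : Prop :=
  [/\ forall t : R, t \in `[0, T] -> continuous_on 0 1 (x t),
      forall s : R, s \in `[0, 1] -> continuous_on 0 T (x^~ s)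
    & forall t s : R, t \in `[0, T] -> s \in `[0, 1] ->
        x t s = x0 s + vintegral 0 t (fun r => A s *m x r s + B s *m u r)].

Definition averaged_controllable {R : realType} (n m : nat)
    (A : R -> 'M[R]_n) (B : R -> 'M[R]_(n, m)) : Prop :=
  forall (x0 : 'cV[R]_n) (xi : R -> 'cV[R]_n) (xstar : 'cV[R]_n) (T : R),
    continuous_on 0 1 xi -> vintegral 0 1 xi = x0 -> 0 < T ->
    exists (u : R -> 'cV[R]_m) (x : R -> R -> 'cV[R]_n),
      [/\ L1_control T u, ensemble_solution A B T xi u x
        & vintegral 0 1 (x T) = xstar].

Definition structurally_averaged_controllable (R : realType) (n m : nat)
    (G : sparsity_pattern n m) : Prop :=
  exists (A : R -> 'M[R]_n) (B : R -> 'M[R]_(n, m)),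
    compliant G A B /\ averaged_controllable A B.

Definition directed_tree (V : finType) (t : rel V) (r : V) : Prop :=
  [/\ forall v, ~~ t v r,
      forall v, v != r -> #|[set u | t u v]%SET| = 1%N
    & forall v, connect t r v].

Definition directed_spanning_tree (V : finType) (e t : rel V) (r : V) : Prop :=
  subrel t e /\ directed_tree t r.

Definition has_path_of_length (V : finType) (t : rel V) (r v : V) (k : nat) :
    bool :=
  [exists q : k.-tuple V, path t r q && (last r q == v)].

(* [find] returns the least k admitting a path of length k from r to v; in a
   tree there is only one such k, see [tree_depth_path]. *)
Definition tree_depth (V : finType) (t : rel V) (r v : V) : nat :=
  find (has_path_of_length t r v) (iota 0 #|V|).

Lemma directed_tree_path_uniq (V : finType) (t : rel V) (r : V) (p q : seq V) :
  directed_tree t r -> path t r p -> path t r q -> last r p = last r q ->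
  p = q.
Proof.
case=> root_in other_in _.
elim/last_ind: p q => [|p x IHp] q; elim/last_ind: q => [|q y _] //.
- rewrite rcons_path last_rcons => _ /andP[_ tq] /= ry.
  by case/negP: (root_in (last r q)); rewrite [X in t _ X]ry.
- rewrite rcons_path last_rcons => /andP[_ tp] _ /= xr.
  by case/negP: (root_in (last r p)); rewrite -[X in t _ X]xr.
rewrite !rcons_path !last_rcons => /andP[pp tp] /andP[pq tq] xy.
rewrite -{}xy in tq *; congr rcons; apply: IHp => //.
have xr : x != r by apply: contraTneq tp => ->; exact: root_in.
have /eqP/cards1P[z Ez] := other_in x xr.
have : last r p \in [set u | t u x]%SET by rewrite inE.
have : last r q \in [set u | t u x]%SET by rewrite inE.
by rewrite Ez !inE => /eqP-> /eqP->.
Qed.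

Lemma tree_depth_path (V : finType) (t : rel V) (r : V) (q : seq V) :
  directed_tree t r -> path t r q -> tree_depth t r (last r q) = size q.
Proof.
move=> tree pq.
have lenP k : has_path_of_length t r (last r q) k -> k = size q.
  case/existsP=> s /andP[ps /eqP ls].
  by rewrite -(directed_tree_path_uniq tree ps pq ls) size_tuple.
have sq : (size q < #|V|)%N.
  have: exists2 q', path t r q' & uniq (r :: q') /\ last r q = last r q'.
    by case: (shortenP pq) => q' pq' uq' _; exists q'.
  case=> q' pq' [uq' lq]; rewrite (directed_tree_path_uniq tree pq pq' lq).
  by have := max_card (mem (r :: q')); rewrite (card_uniqP uq').
have hq : has_path_of_length t r (last r q) (size q).
  by apply/existsP; exists (in_tuple q); rewrite pq eqxx.
have hs : has (has_path_of_length t r (last r q)) (iota 0 #|V|).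
  by apply/hasP; exists (size q) => //; rewrite mem_iota.
have := nth_find 0%N hs; rewrite nth_iota; last by rewrite -[ltnRHS](size_iota 0) -has_find.
by rewrite add0n => /lenP.
Qed.

Definition level (V : finType) (t : rel V) (r : V) (k : nat) : {set V} :=
  [set v | tree_depth t r v == k]%SET.

Definition max_depth (V : finType) (t : rel V) (r : V) : nat :=
  \max_(v : V) tree_depth t r v.

Definition ell (V : finType) (t : rel V) (r : V) (j : nat) : nat :=
  (1 + \sum_(1 <= k < j) #|level t r k|)%N.

(* The row and column indices i and j start at 0 here. *)
Definition hilbert_mx (R : realType) (n : nat) : 'M[R]_n :=
  \matrix_(i, j) (i + j + 1)%:R^-1.

(* [l k] is l_k for 1 <= k <= gamma; its other values are irrelevant. *)
Definition sparse_hilbert_mx (R : realType) (n gamma : nat) (l : nat -> nat) :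
    'M[R]_n :=
  \matrix_(i, j)
    if (j.+1 <= gamma)%N && (l j.+1 < i.+1)%N then 0 else hilbert_mx R n i j.

(* Main.v *)
Require Import Defs.
From mathcomp Require Import all_boot all_order all_algebra.
From mathcomp Require Import ring.
From mathcomp Require Import all_classical all_reals all_analysis.

Set Implicit Arguments.
Unset Strict Implicit.
Unset Printing Implicit Defensive.

Import Order.TTheory GRing.Theory Num.Theory.
Import numFieldNormedType.Exports.

Local Open Scope ring_scope.

(** The pair realizing controllability is explicit.  Order the alpha-nodes by
depth, breaking ties arbitrarily, and let [rk v] be the 0-based position of
[v].  Put [s] on the self-loop of the root, [s ^+ (rk v - rk u + 1)] on every
tree edge from [u] to [v], and let the control enter the root with gain 1.
The only walk of length [k] from the root to [v] loops at the root before
descending, and its weight telescopes to [s ^+ (rk v + k)]; there is none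
when [k] is less than the depth of [v].  Hence
  (\int_0^1 A(s)^k B(s) ds)_v = [depth v <= k] / (rk v + k + 1),
and, since [rk v] is at least [ell (k+1)] exactly when [v] is deeper than [k],
the first [n] of these moments are the columns of the sparse Hilbert matrix,
up to the permutation [rk] of the rows.  Invertibility of that matrix
([tree_moments_independent]) thus says that the moments span R^n.

That spanning moments imply averaged controllability
([averaged_controllable_moments]) is proved without matrix exponentials, by
writing solutions down.  The loop is the only cycle, so a walk of length [n]
has to use it, A(s)^(n+1) = s A(s)^n, and the series
\sum_k t^(k+q)/(k+q)! A^k v is a polynomial in t plus one scalar entire
function times A^n v ([response]).  With v the initial profile and q = 0 this
is the free motion; with v = B and q = 2 it is the response, from rest, to a
unit ramp.  The control is a
combination of ramps started at times [T - e_i]; since the system does not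
depend on time, the contribution of the i-th ramp to the averaged state at [T]
is y(e_i), where y(e) is the average of the ramp response at time [e].  The
expansion
  y(e) = \sum_(k < n) e^(k+2)/(k+2)! \int_0^1 A^k B + O(e^(n+2))
shows that a row vector vanishing on all y(e) with 0 < e <= T annihilates all
the moments, hence is zero.  So finitely many y(e_i) span R^n, and suitable
ramp amplitudes steer the average to any target. *)

(** * Depth in a rooted tree *)

Section TreeDepth.
Local Open Scope nat_scope.
Variables (V : finType) (t : rel V) (r : V).
Hypothesis tree : directed_tree t r.

Lemma tree_path_from_root v : exists2 q, path t r q & v = last r q.
Proof. by case: tree => _ _ /(_ v)/connectP[q]; exists q. Qed.

Lemma tree_depth_step u v : t u v -> tree_depth t r v = (tree_depth t r u).+1.
Proof.
have [q pq ->] := tree_path_from_root u => tuv.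
have -> : v = last r (rcons q v) by rewrite last_rcons.
by rewrite !tree_depth_path ?rcons_path ?pq ?size_rcons.
Qed.

Lemma tree_depth_root : tree_depth t r r = 0.
Proof. exact: (tree_depth_path tree (q := [::])). Qed.

Lemma tree_depth_eq0 v : (tree_depth t r v == 0) = (v == r).
Proof.
apply/eqP/eqP => [|->]; last exact: tree_depth_root.
have [q pq ->] := tree_path_from_root v.
by rewrite tree_depth_path // => /size0nil ->.
Qed.

Lemma tree_parent v : v != r -> exists2 u, t u v & forall w, t w v -> w = u.
Proof.
case: tree => _ one_parent _ /one_parent/eqP/cards1P[u Eu].
have tE w : t w v = (w == u) by rewrite -[RHS]finset.in_set1 -Eu inE.
by exists u => [|w]; rewrite tE // => /eqP.
Qed.

Lemma tree_depth_lt_card v : tree_depth t r v < #|V|.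
Proof.
have [q pq ->] := tree_path_from_root v; rewrite tree_depth_path //.
have [q' pq' [uq' lq]] :
    exists2 q', path t r q' & uniq (r :: q') /\ last r q = last r q'.
  by case/shortenP: pq => q' pq' uq' _; exists q'.
rewrite (directed_tree_path_uniq tree pq pq' lq).
by have := max_card (mem (r :: q')); rewrite (card_uniqP uq').
Qed.

(** The leading 1 in [ell] counts the root, the only node of depth 0. *)
Lemma ell_card j : ell t r j.+1 = #|[set u | tree_depth t r u <= j]%SET|.
Proof.
rewrite /ell; elim: j => [|j IHj].
  rewrite big_geq // addn0 -(cards1 r); apply: eq_card => u.
  by rewrite !inE leqn0 tree_depth_eq0.
rewrite big_nat_recr //= addnA IHj.
rewrite -[RHS](cardsID [set u | tree_depth t r u <= j]).
congr (_ + _); last first.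
  rewrite /level; apply: eq_card => u.
  by rewrite !inE -ltnNge eqn_leq andbC.
apply: eq_card => u; rewrite !inE.
by apply/idP/andP => [le_uj|[]//]; split=> //; apply: leqW.
Qed.

End TreeDepth.

(** * Ordering the nodes by depth *)

Section Rank.
Local Open Scope nat_scope.
Variables (V : finType) (key : V -> nat).
Hypothesis key_inj : injective key.

Definition rank v := #|[set u | key u < key v]|.

Lemma ltn_rank u v : (rank u < rank v) = (key u < key v).
Proof.
have sub x y : key x <= key y ->
    [set z | key z < key x] \subset [set z | key z < key y].
  move=> le_xy; apply/fintype.subsetP => z; rewrite !inE => lt_zx.
  exact: leq_trans le_xy.
apply/idP/idP => [|lt_uv].
  by rewrite !ltnNge; apply: contra => /sub/subset_leq_card.
apply: proper_card; rewrite properE sub ?(ltnW lt_uv) //=.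
by apply/fintype.subsetPn; exists u; rewrite !inE // ltnn.
Qed.

Lemma rank_inj : injective rank.
Proof.
move=> u v E; apply: key_inj.
by case: (ltngtP (key u) (key v)) => //; rewrite -ltn_rank E ltnn.
Qed.

Lemma ltn_rank_card v : rank v < #|V|.
Proof.
rewrite -cardsT; apply: proper_card.
rewrite properE finset.subsetT; apply/fintype.subsetPn.
by exists v; rewrite !inE // ltnn.
Qed.

End Rank.

Section DepthRank.
Local Open Scope nat_scope.
Variables (n : nat) (t : rel 'I_n) (r : 'I_n).
Hypothesis tree : directed_tree t r.
Local Notation depth := (tree_depth t r).

(** Compares lexicographically, depth first and label second, because labels
are smaller than [n]. *)
Definition depth_key (v : 'I_n) := depth v * n + v.

Lemma depth_key_mono u v : depth u < depth v -> depth_key u < depth_key v.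
Proof.
move=> lt_uv; rewrite /depth_key; apply: (@leq_trans (depth v * n)).
  apply: (@leq_trans ((depth u).+1 * n)).
    by rewrite mulSn addnC ltn_add2r.
  by rewrite leq_mul2r lt_uv orbT.
exact: leq_addr.
Qed.

Lemma depth_key_inj : injective depth_key.
Proof.
move=> u v E; apply: val_inj.
have Ed : depth u = depth v.
  by case: (ltngtP (depth u) (depth v)) => // /depth_key_mono; rewrite E ltnn.
by move: E; rewrite /depth_key Ed => /addnI.
Qed.

Definition depth_rank : 'I_n -> nat := rank depth_key.

Lemma depth_rank_lt v : depth_rank v < n.
Proof. by rewrite -[ltnRHS]card_ord; apply: ltn_rank_card. Qed.

Lemma depth_rank_root : depth_rank r = 0.
Proof.
apply/eqP; rewrite cards_eq0 -finset.subset0; apply/fintype.subsetP => u.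
rewrite !inE; case: (eqVneq u r) => [->|]; first by rewrite ltnn.
rewrite -(tree_depth_eq0 tree) -lt0n => lt0u.
have /depth_key_mono : depth r < depth u by rewrite (tree_depth_root tree).
by move=> lt1 /(ltn_trans lt1); rewrite ltnn.
Qed.

Lemma depth_rank_step u v : t u v -> depth_rank u < depth_rank v.
Proof.
move=> /(tree_depth_step tree) E.
by rewrite ltn_rank depth_key_mono // E.
Qed.

(** Nodes of depth at most [j] come first in the ordering, and [ell j.+1] is
their number. *)
Lemma ell_le_depth_rank j v : (ell t r j.+1 <= depth_rank v) = (j < depth v).
Proof.
rewrite (ell_card tree); apply/idP/idP => [|lt_jv].
  apply: contraLR; rewrite -leqNgt -ltnNge => le_vj.
  apply: (@leq_trans #|v |: [set u | depth_key u < depth_key v]|).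
    by rewrite cardsU1 inE ltnn.
  apply/subset_leq_card/fintype.subsetP => u; rewrite !inE.
  case/predU1P => [->//|lt_uv].
  rewrite (leq_trans _ le_vj) // leqNgt; apply/negP => /depth_key_mono.
  by rewrite ltnNge ltnW.
apply/subset_leq_card/fintype.subsetP => u; rewrite !inE => le_uj.
by apply/depth_key_mono/(leq_ltn_trans le_uj).
Qed.

(** A node deeper than [k] makes [k < max_depth], so that the bound on the
column index in [sparse_hilbert_mx] holds whenever the entry has to vanish. *)
Lemma sparse_hilbert_mx_depth_rank (R : realType) (v k i : 'I_n) :
  i = depth_rank v :> nat ->
  sparse_hilbert_mx R n (max_depth t r) (ell t r) i k =
  (if (k < depth v)%N then 0 else (depth_rank v + k).+1%:R^-1)%R.
Proof.
move=> Ei; rewrite !mxE Ei ltnS ell_le_depth_rank addn1.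
case: (ltnP k (depth v)) => [lt_kv|_]; last by rewrite andbF.
by rewrite (leq_trans lt_kv (leq_bigmax v)).
Qed.

End DepthRank.

(** * The weighted tree matrix and its powers *)

Section TreeMatrix.
Variables (R : realType) (n : nat) (t : rel 'I_n) (r : 'I_n).
Hypothesis tree : directed_tree t r.
Local Notation depth := (tree_depth t r).
Local Notation rk := (depth_rank t r).

(** The exponent telescopes along the path from the root: the product of the
weights down to [v] is [s] to the rank of [v] plus its depth. *)
Definition tree_mx (s : R) : 'M[R]_n :=
  \matrix_(v, u) if (v == r) && (u == r) then s
                 else if t u v then s ^+ (rk v - rk u).+1 else 0.

Definition root_cv : 'cV[R]_n := delta_mx r 0.

Lemma tree_mx_mul_root s (x : 'cV[R]_n) : (tree_mx s *m x) r 0 = s * x r 0.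
Proof.
rewrite mxE (bigD1 r) //= mxE eqxx /= big1 ?addr0 // => u /negPf r'u.
rewrite mxE r'u andbF; case: tree => /(_ u)/negPf-> _ _.
by rewrite mul0r.
Qed.

Lemma tree_mx_mul_step s (x : 'cV[R]_n) u v : t u v ->
  (tree_mx s *m x) v 0 = s ^+ (rk v - rk u).+1 * x u 0.
Proof.
move=> tuv; have r'v : v != r.
  by apply: contraTneq tuv => ->; case: tree.
have [w twv w_uniq] := tree_parent tree r'v.
rewrite mxE (bigD1 u) //= mxE (negPf r'v) tuv big1 ?addr0 // => z z'u.
rewrite mxE (negPf r'v) /=; case: ifP => [/w_uniq Ez|_]; last by rewrite mul0r.
by rewrite Ez -(w_uniq _ tuv) eqxx in z'u.
Qed.

(** Beyond the [depth v] steps needed to descend to [v], the remaining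
[k - depth v] steps are spent on the loop, so that the depth cancels in the
exponent. *)
Lemma iter_tree_mx_root s k v :
  iter k (mulmx (tree_mx s)) root_cv v 0 =
  if (k < depth v)%N then 0 else s ^+ (rk v + k).
Proof.
elim: k v => [|k IHk] v /=.
  rewrite lt0n (tree_depth_eq0 tree) mxE eqxx andbT.
  by case: eqVneq => [->|] //=; rewrite (depth_rank_root tree).
have [->|] := eqVneq v r.
  rewrite tree_mx_mul_root IHk (tree_depth_root tree) (depth_rank_root tree) /=.
  by rewrite -exprS.
case/(tree_parent tree) => u tuv _.
rewrite (tree_mx_mul_step _ _ tuv) IHk (tree_depth_step tree tuv) ltnS.
case: ifP => _; first by rewrite mulr0.
rewrite -exprD; congr (s ^+ _).
by rewrite -addSnnS addSn addnA subnK // ltnW // (depth_rank_step tree).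
Qed.

(** Walks backwards from [v] reach the root after [depth v] steps and can only
loop there afterwards. *)
Lemma iter_tree_mx_step s k v (x : 'cV[R]_n) : (depth v <= k)%N ->
  iter k.+1 (mulmx (tree_mx s)) x v 0 = s * iter k (mulmx (tree_mx s)) x v 0.
Proof.
elim: k v => [|k IHk] v.
  by rewrite leqn0 (tree_depth_eq0 tree) => /eqP->; exact: tree_mx_mul_root.
have [-> _|] := eqVneq v r; first exact: tree_mx_mul_root.
case/(tree_parent tree) => u tuv _; rewrite (tree_depth_step tree tuv) => le_uk.
have iterE j := tree_mx_mul_step s (iter j (mulmx (tree_mx s)) x) tuv.
by rewrite (iterE k.+1) (iterE k) IHk // mulrCA.
Qed.

Lemma iter_tree_mx_geometric s (x : 'cV[R]_n) :
  iter n.+1 (mulmx (tree_mx s)) x = s *: iter n (mulmx (tree_mx s)) x.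
Proof.
apply/colP => v; rewrite [RHS]mxE; apply: (iter_tree_mx_step s).
by rewrite ltnW // -[ltnRHS]card_ord; exact: tree_depth_lt_card.
Qed.

End TreeMatrix.

Local Open Scope classical_set_scope.
Local Open Scope ring_scope.

(** * Tails of the exponential series *)

Lemma is_derive_ext (R : realType) (f g : R -> R) (x df dg : R) :
  is_derive x 1 f df -> f =1 g -> df = dg -> is_derive x 1 g dg.
Proof. by move=> dfx /funext <- <-. Qed.

Lemma is_derive_lin_comb (R : realType) (I : Type) (r : seq I) (c : I -> R)
    (f : I -> R -> R) (x : R) (df : I -> R) :
  (forall k, is_derive x 1 (f k) (df k)) ->
  is_derive x 1 (fun u => \sum_(k <- r) c k * f k u) (\sum_(k <- r) c k * df k).
Proof.
move=> dE; elim: r => [|k r IHr].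
  have d0 := is_derive_cst (0 : R) x 1.
  by apply: (is_derive_ext d0) => [u|]; rewrite big_nil.
have dD := is_deriveD (is_deriveZ (c k) (dE k)) IHr.
by apply: (is_derive_ext dD) => [u|]; rewrite big_cons.
Qed.

Section ExponentialTail.
Variable R : realType.
Implicit Types (x s t : R) (c : R^nat) (k : nat).

Lemma is_cvg_pseries_fact c x :
  (forall j, `|c j| <= j`!%:R^-1) -> cvgn (pseries c x).
Proof.
move=> c_le; apply: normed_cvg; rewrite /normed_series_of /=.
apply: (@series_le_cvg _ _ (exp_coeff `|x|)) => [j|j|j|].
- exact: normr_ge0.
- by rewrite /exp_coeff /= divr_ge0 ?exprn_ge0 ?ler0n.
- by rewrite /exp_coeff /= normrM normrX mulrC ler_wpM2l ?exprn_ge0.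
- exact: is_cvg_series_exp_coeff.
Qed.

Definition fact_tail k : R^nat := fun j => (j + k)`!%:R^-1.

(** The phi-functions of exponential integrators: [phi k x] is
(e^x - \sum_(j < k) x^j / j!) / x^k, with the singularity at 0 removed. *)
Definition phi k x : R := limn (pseries (fact_tail k) x).

Lemma fact_tail_le k j : `|fact_tail k j| <= j`!%:R^-1.
Proof.
rewrite ger0_norm ?invr_ge0 ?ler0n // lef_pV2 ?posrE ?ltr0n ?fact_gt0 //.
by rewrite ler_nat leq_fact // leq_addr.
Qed.

Lemma is_cvg_phi k x : cvgn (pseries (fact_tail k) x).
Proof. exact/is_cvg_pseries_fact/fact_tail_le. Qed.

Lemma pseries_diffs_fact_le c :
  (forall j, `|c j| <= j`!%:R^-1) ->
  forall j, `|pseries_diffs c j| <= j`!%:R^-1.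
Proof.
move=> c_le j; rewrite normrM normr_nat.
rewrite (le_trans (ler_wpM2l _ (c_le _))) ?ler0n //.
by rewrite factS natrM invfM mulVKf // pnatr_eq0.
Qed.

Lemma continuous_phi k : continuous (phi k).
Proof.
move=> x; apply: differentiable_continuous; apply/derivable1_diffP.
pose c := fact_tail k; have c0 := @fact_tail_le k.
have c1 := pseries_diffs_fact_le c0; have c2 := pseries_diffs_fact_le c1.
have xK : `|x| < `|(`|x| + 1)|.
  by rewrite [ltRHS]ger0_norm ?addr_ge0 // ltrDl.
by have [] := pseries_snd_diffs (is_cvg_pseries_fact c0)
  (is_cvg_pseries_fact c1) (is_cvg_pseries_fact c2) xK.
Qed.

Lemma phiE k x : phi k x = k`!%:R^-1 + x * phi k.+1 x.
Proof.
apply/cvg_lim => //; rewrite -cvg_shiftS.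
rewrite [X in X @ _ --> _](_ : _ =
  fun m => k`!%:R^-1 + x * pseries (fact_tail k.+1) x m); last first.
  apply/funext => m; rewrite /pseries /series /= big_nat_recl // expr0 mulr1.
  congr (_ + _); rewrite mulr_sumr; apply: eq_bigr => j _.
  by rewrite /fact_tail addSnnS exprS mulrCA.
by apply: cvgD; [exact: cvg_cst | apply: cvgMr; exact: is_cvg_phi].
Qed.

Lemma phi0 x : phi 0 x = expR x.
Proof.
rewrite expRE; congr (limn (pseries _ _)).
by apply/funext => j; rewrite /fact_tail addn0.
Qed.

Definition taylor_monomial k t : R := t ^+ k / k`!%:R.

(** As a function of [t], the sum over [j >= k] of t^j s^(j-k) / j!, which is
the [k]-fold iterated integral of e^(st). Being written with [phi] it stays
continuous in [s] at [s = 0]. *)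
Definition exp_tail k s t : R := t ^+ k * phi k (t * s).

Lemma exp_tailE k s t :
  exp_tail k s t = taylor_monomial k t + s * exp_tail k.+1 s t.
Proof. by rewrite /exp_tail phiE mulrDr exprSr; congr (_ + _); ring. Qed.

Lemma is_derive_taylor_monomial k t :
  is_derive t 1 (taylor_monomial k.+1) (taylor_monomial k t).
Proof.
have dp := is_derive_poly ((k.+1)`!%:R^-1 *: 'X^(k.+1) : {poly R}) t.
apply: (is_derive_ext dp).
  by move=> u; rewrite hornerZ hornerXn mulrC.
rewrite derivZ derivXn hornerZ hornerMn hornerXn /taylor_monomial.
rewrite factS natrM -mulr_natr /=.
by field; rewrite nat1r !pnatr_eq0 -lt0n fact_gt0.
Qed.

Lemma continuous_taylor_monomial k : continuous (@taylor_monomial k).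
Proof. by move=> t; apply: cvgMl; exact: exprn_continuous. Qed.

Lemma continuous_exp_tail_time k s : continuous (exp_tail k s).
Proof.
move=> t; apply: cvgM; first exact: exprn_continuous.
have : {for t, continuous (phi k \o (fun u => u * s))}; last exact.
apply: continuous_comp; last exact: continuous_phi.
by apply: cvgMl; exact: cvg_id.
Qed.

Lemma continuous_exp_tail_rate k t : continuous (fun s => exp_tail k s t).
Proof.
move=> s; apply: cvgMr.
have : {for s, continuous (phi k \o (fun u => t * u))}; last exact.
apply: continuous_comp; last exact: continuous_phi.
by apply: cvgMr; exact: cvg_id.
Qed.

Lemma exp_tail0 k t : exp_tail k 0 t = taylor_monomial k t.
Proof. by rewrite exp_tailE mul0r addr0. Qed.

(** For [s != 0], [exp_tailE] expresses each tail through the previous one,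
which reduces the claim to the derivative of the exponential; for [s = 0] the
tail is a monomial. *)
Lemma is_derive_exp_tail k s t :
  is_derive t 1 (exp_tail k.+1 s) (exp_tail k s t).
Proof.
have [->|s_neq0] := eqVneq s 0.
  rewrite exp_tail0 (_ : exp_tail _ _ = taylor_monomial k.+1).
    exact: is_derive_taylor_monomial.
  by apply/funext => u; rewrite exp_tail0.
have tailS j u :
    exp_tail j.+1 s u = s^-1 * (exp_tail j s u - taylor_monomial j u).
  by rewrite (exp_tailE j) addrC addKr mulKf.
elim: k => [|k IHk]; last first.
  have dE := is_deriveZ s^-1 (is_deriveB IHk (is_derive_taylor_monomial k t)).
  by apply: (is_derive_ext dE) => [u|]; rewrite tailS.
have dexp : is_derive t 1 (fun u => expR (u * s)) (s * expR (t * s)).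
  have dm := is_deriveM (is_derive_id t 1) (is_derive_cst s t 1).
  have := @is_derive1_comp _ expR (id * cst s) t _ _
    (is_derive_expR (t * s)) dm.
  rewrite scaler0 add0r => dE; apply: (is_derive_ext dE) => //.
  by rewrite mulrC; congr (_ * _); exact: mulr1.
have dE := is_deriveZ s^-1 (is_deriveB dexp (is_derive_cst (1 : R) t 1)).
apply: (is_derive_ext dE) => [u|];
  rewrite ?tailS /exp_tail /taylor_monomial !expr0.
  by rewrite mul1r phi0 fact0 divr1.
by rewrite mul1r subr0 phi0 /GRing.scale /= mulKf.
Qed.

End ExponentialTail.

(** * Integrals of continuous functions on segments *)

Section ContinuousIntegrals.
Variable R : realType.
Implicit Types (a b : R) (f : R -> R) (D : set R).

Lemma continuous_sum (T : topologicalType) (I : Type) (r : seq I)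
    (f : I -> T -> R) :
  (forall i, continuous (f i)) -> continuous (fun s => \sum_(i <- r) f i s).
Proof.
move=> cf; elim: r => [|i r IHr].
  rewrite (_ : (fun _ => _) = cst 0); first by move=> s; exact: cvg_cst.
  by apply/funext => s; rewrite big_nil.
rewrite (_ : (fun _ => _) = fun s => f i s + \sum_(j <- r) f j s).
  by move=> s; apply: cvgD; [exact: cf | exact: IHr].
by apply/funext => s; rewrite big_cons.
Qed.

Lemma integrable_segment a b f : {within `[a, b], continuous f} ->
  lebesgue_measure.-integrable `[a, b] (EFin \o f).
Proof.
by move=> cf; apply: continuous_compact_integrable cf; exact: segment_compact.
Qed.

Lemma RintegralZl_segment a b (c : R) f : {within `[a, b], continuous f} ->
  \int[lebesgue_measure]_(s in `[a, b]) (c * f s) =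
  c * \int[lebesgue_measure]_(s in `[a, b]) f s.
Proof. by move=> cf; rewrite RintegralZl //; exact: integrable_segment. Qed.

Lemma RintegralD_segment a b f g :
  {within `[a, b], continuous f} -> {within `[a, b], continuous g} ->
  \int[lebesgue_measure]_(s in `[a, b]) (f s + g s) =
  \int[lebesgue_measure]_(s in `[a, b]) f s +
  \int[lebesgue_measure]_(s in `[a, b]) g s.
Proof. by move=> cf cg; rewrite RintegralD //; exact: integrable_segment. Qed.

Lemma Rintegral_lin_comb (I : Type) (r : seq I) a b (c : I -> R)
    (f : I -> R -> R) :
  (forall i, {within `[a, b], continuous f i}) ->
  \int[lebesgue_measure]_(s in `[a, b]) (\sum_(i <- r) c i * f i s) =
  \sum_(i <- r) c i * \int[lebesgue_measure]_(s in `[a, b]) f i s.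
Proof.
move=> cf; elim: r => [|i r IHr].
  rewrite big_nil; under eq_Rintegral do rewrite big_nil.
  by rewrite Rintegral_cst // mul0r.
rewrite big_cons; under eq_Rintegral do rewrite big_cons.
rewrite RintegralD_segment ?IHr ?RintegralZl_segment //.
  by move=> s; apply: cvgMr; exact: cf.
by apply: (@continuous_sum (subspace `[a, b])) => j s; apply: cvgMr; exact: cf.
Qed.

Lemma Rintegral_is_derive a b (F f : R -> R) : a <= b ->
  (forall x : R, is_derive x 1 F (f x)) -> continuous f ->
  \int[lebesgue_measure]_(s in `[a, b]) f s = F b - F a.
Proof.
rewrite le_eqVlt => /predU1P[->|lt_ab] dF cf.
  by rewrite set_itv1 Rintegral_set1 subrr.
have cF : continuous F.
  move=> x; apply: differentiable_continuous; apply/derivable1_diffP.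
  by case: (dF x).
rewrite /Rintegral (@continuous_FTC2 _ f F) //.
- exact: continuous_subspaceT.
- split.
  + by move=> x _; case: (dF x).
  + exact/cvg_at_right_filter/cF.
  + exact/cvg_at_left_filter/cF.
- by move=> x _; rewrite derive1E; case: (dF x).
Qed.

(** The time elapsed since [tau], which is 0 before [tau]. *)
Definition delay (tau t : R) : R := Num.max 0 (t - tau).

Lemma continuous_delay tau : continuous (delay tau).
Proof.
move=> x; apply: (@continuous_max R R (cst 0) (fun t => t - tau)).
  exact: cvg_cst.
by apply: cvgB; [exact: cvg_id | exact: cvg_cst].
Qed.

(** Because [f] vanishes at 0, the part of the segment before [tau] contributes
nothing; after [tau] this is the fundamental theorem for a translate of
[F]. *)
Lemma Rintegral_delay (F f : R -> R) (tau t : R) :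
  (forall x : R, is_derive x 1 F (f x)) -> continuous f -> F 0 = 0 -> f 0 = 0 ->
  0 <= tau -> 0 <= t ->
  \int[lebesgue_measure]_(s in `[0, t]) f (delay tau s) = F (delay tau t).
Proof.
move=> dF cf F0 f0 tau0 t0.
have zero_before b : b <= tau ->
    \int[lebesgue_measure]_(s in `[0, b]) f (delay tau s) = 0.
  move=> b_le; transitivity (\int[lebesgue_measure]_(s in `[0, b]) (0 : R));
    last by rewrite Rintegral_cst // mul0r.
  apply: eq_Rintegral => s; rewrite inE /= in_itv /= => /andP[_ s_le].
  by rewrite /delay max_l ?f0 // subr_le0 (le_trans s_le).
have [t_le|lt_t] := leP t tau.
  by rewrite zero_before // /delay max_l ?F0 // subr_le0.
have int_delay a b :
    lebesgue_measure.-integrable `[a, b] (EFin \o (f \o delay tau)).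
  apply: integrable_segment; apply: continuous_subspaceT => x.
  by apply: continuous_comp; [exact: continuous_delay | exact: cf].
have := @Rintegral_itvB R (f \o delay tau) (BLeft 0) (BRight t) tau
  (int_delay _ _).
rewrite !bnd_simp /= => /(_ tau0 (ltW lt_t)).
rewrite (zero_before tau) // subr0 => ->.
rewrite Rintegral_itv_obnd_cbnd; last first.
  apply: integrableS (int_delay tau t) => //.
  by apply: subset_itvr; rewrite bnd_simp.
rewrite /delay max_r ?subr_ge0 ?(ltW lt_t) //.
transitivity (\int[lebesgue_measure]_(s in `[tau, t]) f (s - tau)).
  apply: eq_Rintegral => s; rewrite inE /= in_itv /= => /andP[le_s _].
  by rewrite /delay /= max_r // subr_ge0.
have dG (x : R) : is_derive x 1 (fun s : R => F (s - tau)) (f (x - tau)).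
  have := @is_derive1_comp _ F (shift (- tau)) x _ _ (dF (x - tau))
    (is_derive_shift x 1 (- tau)).
  by rewrite mulr1.
rewrite (Rintegral_is_derive (ltW lt_t) dG) ?subrr ?F0 ?subr0 // => x.
apply: (@continuous_comp _ _ _ (fun s => s - tau) f); last exact: cf.
by apply: cvgB; [exact: cvg_id | exact: cvg_cst].
Qed.

End ContinuousIntegrals.

(** * Matrix-valued functions *)

Section MatrixFunctions.
Variable R : realType.
Implicit Types (D : set R) (a b : R).

Lemma within_continuous_mxP m n D (M : R -> 'M[R]_(m, n)) :
  {within D, continuous M} <->
  forall i j, {within D, continuous (fun s => M s i j)}.
Proof.
split=> [cM i j s|cM s].
  apply: (@cvg_comp _ _ _ M (fun N : 'M[R]_(m, n) => N i j)); first exact: cM.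
  exact: coord_continuous.
move=> U [V nV sVU].
have : \forall z \near (s : subspace D), forall i j, V i j (M z i j).
  have Fs := @nbhs_filter (subspace D) s.
  apply: filter_forall => i; apply: filter_forall => j.
  by apply: (cM i j s); exact: nV.
by apply: filterS => z Vz; exact: sVU.
Qed.

Lemma within_continuous_mulmx m n p D (M : R -> 'M[R]_(m, n))
    (N : R -> 'M[R]_(n, p)) :
  {within D, continuous M} -> {within D, continuous N} ->
  {within D, continuous (fun s => M s *m N s)}.
Proof.
move=> /within_continuous_mxP cM /within_continuous_mxP cN.
apply/within_continuous_mxP => i k.
rewrite (_ : (fun _ => _) = fun s => \sum_j M s i j * N s j k); last first.
  by apply/funext => s; rewrite mxE.
apply: (@continuous_sum _ (subspace D)) => j s.
by apply: cvgM; [exact: cM | exact: cN].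
Qed.

Lemma within_continuous_addmx m n D (M N : R -> 'M[R]_(m, n)) :
  {within D, continuous M} -> {within D, continuous N} ->
  {within D, continuous (fun s => M s + N s)}.
Proof. by move=> cM cN s; apply: cvgD; [exact: cM | exact: cN]. Qed.

Lemma within_continuous_scalemx m n D (c : R -> R) (M : R -> 'M[R]_(m, n)) :
  {within D, continuous c} -> {within D, continuous M} ->
  {within D, continuous (fun s => c s *: M s)}.
Proof. by move=> cc cM s; apply: cvgZ; [exact: cc | exact: cM]. Qed.

Lemma within_continuous_iter_mulmx n D (A : R -> 'M[R]_n)
    (x : R -> 'cV[R]_n) k :
  {within D, continuous A} -> {within D, continuous x} ->
  {within D, continuous (fun s => iter k (mulmx (A s)) (x s))}.
Proof.
by move=> cA cx; elim: k => //= k IHk; exact: within_continuous_mulmx.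
Qed.

Lemma within_continuous_lin_comb (I : Type) (r : seq I) m n D (c : I -> R -> R)
    (M : I -> R -> 'M[R]_(m, n)) :
  (forall k, {within D, continuous c k}) ->
  (forall k, {within D, continuous M k}) ->
  {within D, continuous (fun s => \sum_(k <- r) c k s *: M k s)}.
Proof.
move=> cc cM; apply/within_continuous_mxP => i j.
rewrite (_ : (fun _ => _) = fun s => \sum_(k <- r) c k s * M k s i j).
  apply: (@continuous_sum _ (subspace D)) => k s; apply: cvgM; first exact: cc.
  by move: s; apply/within_continuous_mxP : i j.
by apply/funext => s; rewrite summxE; under eq_bigr do rewrite mxE.
Qed.

End MatrixFunctions.

Section VectorIntegral.
Variables (R : realType) (n : nat).
Implicit Types (a b t tau : R) (f g F : R -> 'cV[R]_n).

Lemma eq_vintegral a b f g : {in `[a, b], f =1 g} ->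
  vintegral a b f = vintegral a b g.
Proof.
move=> fg; apply/colP => i; rewrite !mxE; apply: eq_Rintegral => s.
by rewrite inE /= => sab; rewrite fg.
Qed.

Lemma vintegralD a b f g : continuous_on a b f -> continuous_on a b g ->
  vintegral a b (fun s => f s + g s) = vintegral a b f + vintegral a b g.
Proof.
move=> /within_continuous_mxP cf /within_continuous_mxP cg; apply/colP => i.
rewrite !mxE -RintegralD_segment //; apply: eq_Rintegral => s _.
by rewrite mxE.
Qed.

Lemma vintegral_lin_comb (I : Type) (r : seq I) a b (c : I -> R)
    (f : I -> R -> 'cV[R]_n) :
  (forall k, continuous_on a b (f k)) ->
  vintegral a b (fun s => \sum_(k <- r) c k *: f k s) =
  \sum_(k <- r) c k *: vintegral a b (f k).
Proof.
move=> cf; apply/colP => i; rewrite mxE summxE.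
transitivity
  (\int[lebesgue_measure]_(s in `[a, b]) (\sum_(k <- r) c k * f k s i 0)).
  by apply: eq_Rintegral => s _; rewrite summxE; under eq_bigr do rewrite mxE.
rewrite Rintegral_lin_comb => [|k].
  by apply: eq_bigr => k _; rewrite !mxE.
by move/within_continuous_mxP: (cf k).
Qed.

Lemma vintegralZ a b (c : R) f : continuous_on a b f ->
  vintegral a b (fun s => c *: f s) = c *: vintegral a b f.
Proof.
move=> cf; have := vintegral_lin_comb [:: tt] (fun _ => c) (fun _ => cf).
by rewrite big_seq1 => <-; apply: eq_vintegral => s _; rewrite big_seq1.
Qed.

Lemma vintegral_FTC a b F f : a <= b ->
  (forall i (x : R), is_derive x 1 (fun s => F s i 0) (f x i 0)) ->
  (forall i, continuous (fun s => f s i 0)) ->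
  vintegral a b f = F b - F a.
Proof.
move=> ab dF cf; apply/colP => i; rewrite !mxE.
exact: (Rintegral_is_derive ab (dF i) (cf i)).
Qed.

Lemma vintegral_delay F f tau t :
  (forall i (x : R), is_derive x 1 (fun s => F s i 0) (f x i 0)) ->
  (forall i, continuous (fun s => f s i 0)) ->
  F 0 = 0 -> f 0 = 0 -> 0 <= tau -> 0 <= t ->
  vintegral 0 t (fun s => f (delay tau s)) = F (delay tau t).
Proof.
move=> dF cf F0 f0 tau0 t0; apply/colP => i; rewrite mxE.
by apply: (Rintegral_delay (dF i) (cf i)); rewrite ?F0 ?f0 ?mxE.
Qed.

End VectorIntegral.

(** * Explicit solutions of the linear equation *)

Section KrylovResponse.
Variables (R : realType) (n N : nat).
Implicit Types (A : 'M[R]_n) (s t : R) (x : 'cV[R]_n) (q : nat).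

(** The series \sum_k t^(k+q)/(k+q)! A^k x, summed in closed form from the
index [N] on, where [A^k x] is supposed to become geometric of ratio [s].
It is the [q]-fold iterated integral in time of the free motion e^(tA) x. *)
Definition response A s x q t : 'cV[R]_n :=
  \sum_(k < N) taylor_monomial (k + q) t *: iter k (mulmx A) x
  + exp_tail (N + q) s t *: iter N (mulmx A) x.

Lemma responseE A s x q t i :
  response A s x q t i 0 =
  \sum_(k < N) taylor_monomial (k + q) t * iter k (mulmx A) x i 0
  + exp_tail (N + q) s t * iter N (mulmx A) x i 0.
Proof. by rewrite !mxE summxE; under eq_bigr do rewrite mxE. Qed.

Lemma mulmx_response A s x q t :
  A *m response A s x q t = response A s (A *m x) q t.
Proof.
rewrite /response mulmxDr mulmx_sumr -scalemxAr -iterS iterSr; congr (_ + _).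
by apply: eq_bigr => k _; rewrite -scalemxAr -iterS iterSr.
Qed.

(** The differential equation in disguise: by [is_derive_response] the
left-hand side is the time derivative of [response A s x q.+1]. *)
Lemma responseS A s x q t :
  iter N.+1 (mulmx A) x = s *: iter N (mulmx A) x ->
  response A s x q t = A *m response A s x q.+1 t + taylor_monomial q t *: x.
Proof.
move=> geometric.
rewrite /response mulmxDr mulmx_sumr -scalemxAr -iterS geometric.
rewrite addrC exp_tailE scalerDl scalerA mulrC addnS addrAC [RHS]addrAC.
congr (_ + _).
transitivity (\sum_(k < N.+1) taylor_monomial (k + q) t *: iter k (mulmx A) x).
  by rewrite big_ord_recr addrC.
rewrite big_ord_recl addrC; congr (_ + _); apply: eq_bigr => k _.
by rewrite -scalemxAr addnS.
Qed.

Lemma is_derive_response A s x q t i :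
  is_derive t 1 (fun u => response A s x q.+1 u i 0) (response A s x q t i 0).
Proof.
have dE := is_deriveD
  (is_derive_lin_comb (index_enum 'I_N) (fun k => iter k (mulmx A) x i 0)
    (fun k => is_derive_taylor_monomial (k + q) t))
  (is_deriveZ (iter N (mulmx A) x i 0) (is_derive_exp_tail (N + q) s t)).
apply: (is_derive_ext dE) => [u|]; rewrite responseE; congr (_ + _).
- by apply: eq_bigr => k _; rewrite addnS mulrC.
- by rewrite addnS mulrC.
- by apply: eq_bigr => k _; rewrite mulrC.
- by rewrite mulrC.
Qed.

Lemma continuous_response A s x q i :
  continuous (fun t => response A s x q t i 0).
Proof.
have -> : (fun t => response A s x q t i 0) = fun t =>
    \sum_(k < N) taylor_monomial (k + q) t * iter k (mulmx A) x i 0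
    + exp_tail (N + q) s t * iter N (mulmx A) x i 0.
  by apply/funext => t; exact: responseE.
move=> t; apply: cvgD; last by apply: cvgMl; exact: continuous_exp_tail_time.
apply: continuous_sum => k u; apply: cvgMl; exact: continuous_taylor_monomial.
Qed.

Lemma responseS0 A s x q : response A s x q.+1 0 = 0.
Proof.
rewrite /response /exp_tail addnS exprS !mul0r scale0r addr0 big1 // => k _.
by rewrite /taylor_monomial addnS exprS !mul0r scale0r.
Qed.

End KrylovResponse.

(** * Ensembles driven by ramps *)

Section RampControls.
Variables (R : realType) (n N : nat) (A : R -> 'M[R]_n) (B : R -> 'cV[R]_n).
Hypothesis contA : continuous_on 0 1 A.
Hypothesis contB : continuous_on 0 1 B.
Hypothesis geometric : forall s (x : 'cV[R]_n), s \in `[0, 1] ->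
  iter N.+1 (mulmx (A s)) x = s *: iter N (mulmx (A s)) x.

Let resp s := @response R n N (A s) s.

Lemma continuous_response_rate (x : R -> 'cV[R]_n) q t :
  continuous_on 0 1 x -> continuous_on 0 1 (fun s => resp s (x s) q t).
Proof.
move=> cx; apply: within_continuous_addmx.
  apply: (@within_continuous_lin_comb R _ _ _ _ _
    (fun (k : 'I_N) _ => taylor_monomial (k + q) t)) => k.
    by move=> u; exact: cvg_cst.
  exact: within_continuous_iter_mulmx.
apply: within_continuous_scalemx; last exact: within_continuous_iter_mulmx.
exact: (continuous_subspaceT (@continuous_exp_tail_rate R (N + q) t)).
Qed.

Variables (m : nat) (a tau : 'I_m -> R).
Hypothesis tau_ge0 : forall k, 0 <= tau k.

Definition ramp_control (t : R) : 'cV[R]_1 := (\sum_k a k * delay (tau k) t)%:M.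

Definition ramp_state (xi : R -> 'cV[R]_n) (t s : R) : 'cV[R]_n :=
  resp s (xi s) 0 t + \sum_k a k *: resp s (B s) 2 (delay (tau k) t).

Lemma ramp_control_L1 T : L1_control T ramp_control.
Proof.
move=> i; apply: integrable_segment.
rewrite (_ : (fun _ => _) = fun t => \sum_k a k * delay (tau k) t); last first.
  by apply/funext => t; rewrite mxE (ord1 i) eqxx mulr1n.
apply: continuous_subspaceT; apply: continuous_sum => k t.
by apply: cvgMr; exact: continuous_delay.
Qed.

Lemma continuous_response_time D s (x : 'cV[R]_n) q :
  {within D, continuous (resp s x q)}.
Proof.
apply/within_continuous_mxP => i j; rewrite (ord1 j).
by apply: continuous_subspaceT; exact: continuous_response.
Qed.

Lemma continuous_response_delay D s (x : 'cV[R]_n) q (t0 : R) :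
  {within D, continuous (fun t => resp s x q (delay t0 t))}.
Proof.
apply/within_continuous_mxP => i j; rewrite (ord1 j).
apply: continuous_subspaceT => t.
apply: (@continuous_comp _ _ _ (delay t0) (fun u => resp s x q u i 0)).
  exact: continuous_delay.
exact: continuous_response.
Qed.

Lemma continuous_ramp_sum D s (x : 'cV[R]_n) q :
  {within D, continuous (fun t => \sum_k a k *: resp s x q (delay (tau k) t))}.
Proof.
apply: (@within_continuous_lin_comb R _ _ _ _ _ (fun k => cst (a k))) => k.
  by move=> u; exact: cvg_cst.
exact: continuous_response_delay.
Qed.

(** The right-hand side of the ensemble equation along [ramp_state]. Each term
has an antiderivative of the same form, with the index of [response] raised by
one. *)
Lemma mulmx_ramp_state xi t s : s \in `[0, 1] ->
  A s *m ramp_state xi t s + B s *m ramp_control t =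
  resp s (A s *m xi s) 0 t + \sum_k a k *: resp s (B s) 1 (delay (tau k) t).
Proof.
move=> s01; rewrite mulmxDr mulmx_response mulmx_sumr mul_mx_scalar -addrA.
congr (_ + _).
rewrite scaler_suml -big_split /=; apply: eq_bigr => k _.
rewrite -scalemxAr -scalerA -scalerDr; congr (_ *: _).
rewrite [RHS]responseS ?geometric // /taylor_monomial.
by rewrite expr1 factS fact0 muln1 divr1.
Qed.

Lemma ramp_state_solution T xi : continuous_on 0 1 xi ->
  ensemble_solution A B T xi ramp_control (ramp_state xi).
Proof.
move=> cxi; split=> [t _|s _|t s].
- apply: within_continuous_addmx; first exact: continuous_response_rate.
  apply: (@within_continuous_lin_comb R _ _ _ _ _ (fun k => cst (a k))) => k.
    by move=> u; exact: cvg_cst.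
  exact: continuous_response_rate.
- apply: within_continuous_addmx; first exact: continuous_response_time.
  exact: continuous_ramp_sum.
- rewrite in_itv /= => /andP[t0 _] s01.
  rewrite (eq_vintegral (fun r _ => mulmx_ramp_state xi r s01)).
  rewrite vintegralD; last 2 first.
  + exact: continuous_response_time.
  + exact: continuous_ramp_sum.
  rewrite vintegral_lin_comb; last first.
    by move=> k; exact: continuous_response_delay.
  rewrite addrA; congr (_ + _).
    rewrite (vintegral_FTC t0
      (fun i x => is_derive_response N (A s) s (A s *m xi s) 0 x i)
      (fun i => @continuous_response _ _ _ _ _ _ _ i)).
    rewrite responseS0 subr0 -mulmx_response /ramp_state /resp.
    rewrite responseS ?geometric //.
    by rewrite /taylor_monomial expr0 fact0 divr1 scale1r addrC.
  apply: eq_bigr => k _; congr (_ *: _); apply/esym.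
  apply: vintegral_delay => //; [| |exact: responseS0|exact: responseS0].
  + by move=> i x; exact: is_derive_response.
  + by move=> i; exact: continuous_response.
Qed.

End RampControls.

(** * Spanning by short-time values *)

Section SmallTimeExpansion.
Variable R : realType.

(** Letting [e] tend to 0 kills the constant coefficient; dividing by [e] then
gives the same hypothesis for the next coefficients. *)
Lemma small_poly_coef_eq0 N (q : nat -> R) (C T : R) : 0 < T ->
  (forall e, 0 < e <= T -> `|\sum_(k < N) q k * e ^+ k| <= C * e ^+ N) ->
  forall k, (k < N)%N -> q k = 0.
Proof.
move=> T0; elim: N q => // N IHN q le_q.
have q0 : q 0%N = 0.
  apply/eqP; rewrite -normr_le0.
  pose M := C * T ^+ N + \sum_(k < N) `|q k.+1| * T ^+ k.
  have le_M e : 0 < e <= T -> `|q 0%N| <= M * e.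
    move=> /andP[e0 eT]; have := le_q e; rewrite e0 eT => /(_ isT) le_qe.
    rewrite big_ord_recl expr0 mulr1 in le_qe.
    set S := \sum_(i < N) _ in le_qe.
    have leS : `|S| <= (\sum_(k < N) `|q k.+1| * T ^+ k) * e.
      rewrite mulr_suml (le_trans (ler_norm_sum _ _ _)) // ler_sum // => k _.
      rewrite normrM normrX (gtr0_norm e0) exprSr mulrA ler_wpM2r ?(ltW e0) //.
      by rewrite ler_wpM2l // lerXn2r ?nnegrE ?(ltW e0) ?(ltW T0).
    have C0 : 0 <= C.
      by rewrite -(pmulr_lge0 _ (exprn_gt0 N.+1 e0)) (le_trans _ le_qe).
    have leC : C * e ^+ N.+1 <= C * T ^+ N * e.
      rewrite exprSr mulrA ler_wpM2r ?(ltW e0) //.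
      by rewrite ler_wpM2l // lerXn2r ?nnegrE ?(ltW e0) ?(ltW T0).
    rewrite mulrDl -[q 0%N](addrK S) (le_trans (ler_normB _ _)) // lerD //.
    exact: le_trans leC.
  have M0 : 0 <= M.
    by rewrite -(pmulr_lge0 _ T0) (le_trans _ (le_M T _)) // T0 lexx.
  apply/ler_addgt0Pl => e e0; rewrite addr0.
  (* [d] is an admissible time at which the bound [M * d] is at most [e]; the
  denominator is [M + 1] because [M] may be zero. *)
  pose d := Num.min T (e / (M + 1)).
  have M1 : 0 < M + 1 by rewrite ltr_wpDl.
  have d0 : 0 < d by rewrite lt_min T0 divr_gt0.
  apply: le_trans (le_M d _) _; first by rewrite d0 ge_min lexx.
  apply: (@le_trans _ _ ((M + 1) * d)).
    by rewrite ler_wpM2r ?(ltW d0) // lerDl.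
  by rewrite mulrC -ler_pdivlMr // ge_min lexx orbT.
case=> [//|k] ltkN; apply: (IHN (fun k => q k.+1)) => // e eT.
have := le_q e eT; rewrite big_ord_recl q0 mul0r add0r exprSr mulrA.
have e0 : 0 < e by case/andP: eT.
under eq_bigr do rewrite lift0 exprSr mulrA.
by rewrite -mulr_suml normrM (gtr0_norm e0) ler_pM2r.
Qed.

Lemma within_continuous_bounded a b (f : R -> R) : a <= b ->
  {within `[a, b], continuous f} ->
  exists M, forall x, x \in `[a, b] -> `|f x| <= M.
Proof.
move=> ab cf; have cn : {within `[a, b], continuous (fun x => `|f x|)}.
  by move=> x; apply: cvg_norm; exact: cf.
by have [c _ le_c] := EVT_max ab cn; exists `|f c|.
Qed.

Lemma norm_Rintegral_le a b (f : R -> R) M : a <= b ->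
  {within `[a, b], continuous f} -> (forall x, x \in `[a, b] -> `|f x| <= M) ->
  `|\int[lebesgue_measure]_(x in `[a, b]) f x| <= M * (b - a).
Proof.
move=> ab cf le_M; have cn : {within `[a, b], continuous (fun x => `|f x|)}.
  by move=> x; apply: cvg_norm; exact: cf.
apply: le_trans (le_normr_Rintegral _ (integrable_segment cf)) _ => //.
have -> : M * (b - a) = \int[lebesgue_measure]_(x in `[a, b]) M.
  rewrite Rintegral_cst //= lebesgue_measure_itv /= lte_fin.
  by case: ltP => //= ba; rewrite (@le_anti _ _ a b) ?ab ?ba ?subrr.
apply: le_Rintegral => //; first exact: integrable_segment.
by apply: integrable_segment => x; exact: cvg_cst.
Qed.

End SmallTimeExpansion.

Section SpanFromAnnihilator.
Variables (F : fieldType) (n : nat) (X : Type).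
Variables (P : X -> Prop) (y : X -> 'cV[F]_n).
Hypothesis annihilator0 :
  forall p : 'rV[F]_n, (forall x, P x -> p *m y x = 0) -> p = 0.

(** A free family of fewer than [n] vectors has a nonzero annihilator [p];
some [y x] is not killed by [p], hence is independent of the family. *)
Lemma exists_free_family k : (k <= n)%N ->
  exists2 e : 'I_k -> X, (forall i, P (e i)) &
  row_free (\matrix_(i < k) (y (e i))^T).
Proof.
elim: k => [_|k IHk lt_kn].
  exists (fun i : 'I_0 => False_rect X (notF (valP i))) => [[]//|].
  by rewrite /row_free flatmx0 mxrank0.
have [e Pe free_e] := IHk (ltnW lt_kn).
set M := \matrix_(i < k) (y (e i))^T in free_e.
have [p pM p0] : exists2 p : 'rV[F]_n, M *m p^T = 0 & p != 0.
  have : kermx M^T != 0.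
    by rewrite -mxrank_eq0 mxrank_ker mxrank_tr (eqP free_e) -lt0n subn_gt0.
  case/rowV0Pn => p /sub_kermxP pM p0; exists p => //.
  by apply: trmx_inj; rewrite trmx_mul trmxK trmx0.
have [x Px pyx] : exists2 x, P x & p *m y x != 0.
  apply: contrapT => no_x; case/eqP: p0; apply: annihilator0 => x Px.
  by apply/eqP; apply: contrapT => /negP pyx; apply: no_x; exists x.
have free_xM : row_free (col_mx (y x)^T M).
  rewrite -kermx_eq0; apply/rowV0P => w /sub_kermxP.
  rewrite -[w]hsubmxK; set b := lsubmx _; set c := rsubmx _.
  rewrite mul_row_col => bc0.
  have b0 : b = 0.
    have : b *m (p *m y x)^T = 0.
      rewrite trmx_mul mulmxA -[LHS]addr0 -[X in _ + X](mulmx0 _ c) -pM mulmxA.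
      by rewrite -mulmxDl bc0 mul0mx.
    rewrite [p *m _]mx11_scalar tr_scalar_mx mul_mx_scalar => /eqP.
    rewrite scaler_eq0 => /predU1P[pyx0|/eqP//].
    by case/eqP: pyx; rewrite [LHS]mx11_scalar pyx0 raddf0.
  move: bc0; rewrite b0 mul0mx add0r -(mul0mx _ M) => /(row_free_inj free_e) ->.
  by rewrite row_mx0.
pose e' (i : 'I_(1 + k)) := if fintype.split i is inr j then e j else x.
have Pe' i : P (e' i).
  by rewrite /e'; case: fintype.split => [_|j]; [exact: Px|exact: Pe].
exists e' => //; rewrite (_ : \matrix_i _ = col_mx (y x)^T M) //.
apply/matrixP => i j; rewrite [LHS]mxE [RHS]mxE /e'.
by case: fintype.split => l; [rewrite ord1 | rewrite [RHS]mxE].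
Qed.

Lemma exists_spanning_family :
  exists2 e : 'I_n -> X, (forall i, P (e i)) &
  forall v, exists a : 'I_n -> F, v = \sum_i a i *: y (e i).
Proof.
have [e Pe] := exists_free_family (leqnn n).
set M := (X in row_free X); rewrite row_free_unit => unitM.
exists e => // v; exists (fun i => (v^T *m invmx M) 0 i).
apply: trmx_inj; rewrite -[LHS](mulmxKV unitM) mulmx_sum_row linear_sum.
by apply: eq_bigr => i _; rewrite rowK linearZ.
Qed.

End SpanFromAnnihilator.

(** * Averaged controllability from spanning moments *)

Section MomentCriterion.
Variables (R : realType) (n N : nat) (A : R -> 'M[R]_n) (B : R -> 'cV[R]_n).
Hypothesis contA : continuous_on 0 1 A.
Hypothesis contB : continuous_on 0 1 B.
Hypothesis geometric : forall s (x : 'cV[R]_n), s \in `[0, 1] ->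
  iter N.+1 (mulmx (A s)) x = s *: iter N (mulmx (A s)) x.

Let krylov k s := iter k (mulmx (A s)) (B s).

Lemma continuous_krylov k : continuous_on 0 1 (krylov k).
Proof. exact: within_continuous_iter_mulmx. Qed.

Definition averaged_ramp_response (e : R) : 'cV[R]_n :=
  vintegral 0 1 (fun s => response N (A s) s (B s) 2 e).

Lemma continuous_phi_krylov e :
  continuous_on 0 1 (fun s => phi (N + 2) (e * s) *: krylov N s).
Proof.
apply: within_continuous_scalemx; last exact: continuous_krylov.
apply: (@continuous_subspaceT _ _ _ (phi (N + 2) \o ( *%R e))) => s.
apply: continuous_comp; last exact: continuous_phi.
by apply: cvgMr; exact: cvg_id.
Qed.

Lemma averaged_ramp_responseE e :
  averaged_ramp_response e =
  \sum_(k < N) taylor_monomial (k + 2) e *: vintegral 0 1 (krylov k)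
  + e ^+ (N + 2) *: vintegral 0 1 (fun s => phi (N + 2) (e * s) *: krylov N s).
Proof.
transitivity (vintegral 0 1 (fun s =>
    \sum_(k < N) taylor_monomial (k + 2) e *: krylov k s
    + e ^+ (N + 2) *: (phi (N + 2) (e * s) *: krylov N s))).
  by apply: eq_vintegral => s _; rewrite /response /exp_tail scalerA.
rewrite vintegralD ?vintegral_lin_comb ?vintegralZ //.
- exact: continuous_phi_krylov.
- by move=> k; exact: continuous_krylov.
- apply: (@within_continuous_lin_comb R _ _ _ _ _
    (fun (k : 'I_N) _ => taylor_monomial (k + 2) e)) => k.
    by move=> u; exact: cvg_cst.
  exact: continuous_krylov.
- apply: within_continuous_scalemx; last exact: continuous_phi_krylov.
  by move=> u; exact: cvg_cst.
Qed.

Lemma averaged_ramp_remainder_bounded (p : 'rV[R]_n) (T : R) : 0 <= T ->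
  exists C : R, forall e : R, 0 <= e <= T ->
  `|(p *m vintegral 0 1 (fun s => phi (N + 2) (e * s) *: krylov N s)) 0 0| <= C.
Proof.
move=> T0.
have [M le_M] := within_continuous_bounded T0
  (continuous_subspaceT (@continuous_phi R (N + 2))).
have /choice[K le_K] :
    forall i, exists K, forall s, s \in `[0, 1] -> `|krylov N s i 0| <= K.
  move=> i; apply: within_continuous_bounded => //.
  by move/within_continuous_mxP: (@continuous_krylov N).
exists (\sum_i `|p 0 i| * (M * K i)) => e /andP[e0 eT].
rewrite mxE (le_trans (ler_norm_sum _ _ _)) // ler_sum // => i _.
rewrite normrM ler_wpM2l // mxE.
rewrite -[leRHS]mulr1 -[X in _ <= _ * X]subr0; apply: norm_Rintegral_le => //.
  by move/within_continuous_mxP: (@continuous_phi_krylov e).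
move=> s s01; rewrite mxE normrM ler_pM // ?le_K // le_M //.
move: s01; rewrite !in_itv /= => /andP[s0 s1].
by rewrite mulr_ge0 //= (le_trans _ eT) // ler_piMr.
Qed.

Hypothesis moments_independent : forall p : 'rV[R]_n,
  (forall k, (k < N)%N -> p *m vintegral 0 1 (krylov k) = 0) -> p = 0.

(** Divided by [e ^+ 2], the expansion of [p *m averaged_ramp_response e] is a
polynomial in [e] of degree less than [N] that is O(e^N), so its coefficients,
which are the moments of [p] up to factorials, vanish. *)
Lemma averaged_ramp_annihilator0 (T : R) (p : 'rV[R]_n) : 0 < T ->
  (forall e, 0 < e <= T -> p *m averaged_ramp_response e = 0) -> p = 0.
Proof.
move=> T0 py0; apply: moments_independent.
pose q k := (p *m vintegral 0 1 (krylov k)) 0 0 / (k + 2)`!%:R.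
suff q0 k : (k < N)%N -> q k = 0.
  move=> k /q0/eqP.
  rewrite mulf_eq0 invr_eq0 pnatr_eq0 gtn_eqF ?fact_gt0 // orbF.
  by move=> /eqP pc0; rewrite [LHS]mx11_scalar pc0 raddf0.
have [C le_C] := averaged_ramp_remainder_bounded p (ltW T0).
apply: (@small_poly_coef_eq0 R N q C T) => // e eT.
have e0 : 0 < e by case/andP: eT.
pose w u := vintegral 0 1 (fun s => phi (N + 2) (u * s) *: krylov N s).
have E : \sum_(k < N)
      taylor_monomial (k + 2) e * (p *m vintegral 0 1 (krylov k)) 0 0
    + e ^+ (N + 2) * (p *m w e) 0 0 = 0.
  have pye : (p *m averaged_ramp_response e) 0 0 = 0 by rewrite py0 // mxE.
  rewrite -[RHS]pye averaged_ramp_responseE mulmxDr mulmx_sumr -scalemxAr.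
  rewrite [RHS]mxE summxE; congr (_ + _); last by rewrite [RHS]mxE.
  by apply: eq_bigr => j _; rewrite -scalemxAr [RHS]mxE.
have e2 : 0 < e ^+ 2 := exprn_gt0 2 e0.
rewrite -(ler_pM2r e2) -[X in _ * X <= _](gtr0_norm e2) -normrM.
rewrite (_ : _ * _ = - (e ^+ (N + 2) * (p *m w e) 0 0)); last first.
  apply/eqP; rewrite -addr_eq0 -[X in _ == X]E; apply/eqP; congr (_ + _).
  rewrite mulr_suml; apply: eq_bigr => j _.
  by rewrite /q /taylor_monomial exprD; ring.
rewrite normrN normrM (gtr0_norm (exprn_gt0 _ e0)) -mulrA -exprD mulrC.
by rewrite ler_pM2r ?exprn_gt0 //; apply: le_C; rewrite (ltW e0); case/andP: eT.
Qed.

(** The free motion fixes an offset [h]; ramps started at the times [T - e k]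
have run for the time [e k] at the final time, and their averaged responses
span the space, so their amplitudes can be chosen to produce [xstar - h]. *)
Theorem averaged_controllable_moments : averaged_controllable A B.
Proof.
move=> x0 xi xstar T cxi _ T0.
have [e eP span] := exists_spanning_family
  (fun p => @averaged_ramp_annihilator0 T p T0).
pose h := vintegral 0 1 (fun s => response N (A s) s (xi s) 0 T).
have [a aE] := span (xstar - h).
pose tau k := T - e k.
have tau_ge0 k : 0 <= tau k by rewrite subr_ge0; case/andP: (eP k).
exists (ramp_control a tau), (ramp_state N A B a tau xi); split.
- exact: ramp_control_L1.
- exact: ramp_state_solution.
have cB k : continuous_on 0 1
    (fun s => response N (A s) s (B s) 2 (delay (tau k) T)).
  exact: continuous_response_rate.
rewrite vintegralD ?vintegral_lin_comb //; last 2 first.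
- exact: continuous_response_rate.
- apply: (@within_continuous_lin_comb R _ _ _ _ _ (fun k _ => a k)) => // k.
  by move=> u; exact: cvg_cst.
rewrite -/h -[RHS](subrKC h) aE; congr (_ + _); apply: eq_bigr => k _.
rewrite /delay /tau opprB addrCA subrr addr0 max_r //.
by case/andP: (eP k) => /ltW.
Qed.

End MomentCriterion.

(** * The sparse Hilbert matrix as a matrix of moments *)

Lemma Rintegral_exprn (R : realType) m :
  \int[lebesgue_measure]_(s in `[0, 1]) (s ^+ m) = m.+1%:R^-1 :> R.
Proof.
transitivity
  (\int[lebesgue_measure]_(s in `[0, 1]) (m`!%:R * @taylor_monomial R m s)).
  apply: eq_Rintegral => s _.
  by rewrite /taylor_monomial mulrC divfK // pnatr_eq0 -lt0n fact_gt0.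
rewrite RintegralZl_segment; last first.
  by apply: continuous_subspaceT; exact: continuous_taylor_monomial.
rewrite (Rintegral_is_derive ler01 (@is_derive_taylor_monomial R m));
  last exact: continuous_taylor_monomial.
rewrite /taylor_monomial expr1n exprS !mul0r subr0 factS natrM invfM mul1r.
by rewrite mulrC divfK // pnatr_eq0 -lt0n fact_gt0.
Qed.

Section TreeEnsemble.
Variables (R : realType) (n : nat) (t : rel 'I_n) (r : 'I_n).
Hypothesis tree : directed_tree t r.

Lemma continuous_tree_mx : continuous_on 0 1 (@tree_mx R n t r).
Proof.
apply/within_continuous_mxP => v u; apply: continuous_subspaceT.
have [/andP[/eqP-> /eqP->]|not_loop] := boolP ((v == r) && (u == r)).
  rewrite (_ : (fun _ => _) = id); first by move=> s; exact: cvg_id.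
  by apply/funext => s; rewrite mxE !eqxx.
have [tuv|not_tuv] := boolP (t u v).
  rewrite (_ : (fun _ => _) =
    fun s => s ^+ (depth_rank t r v - depth_rank t r u).+1).
    exact: exprn_continuous.
  by apply/funext => s; rewrite mxE (negPf not_loop) tuv.
rewrite (_ : (fun _ => _) = cst 0); first by move=> s; exact: cvg_cst.
by apply/funext => s; rewrite mxE (negPf not_loop) (negPf not_tuv).
Qed.

Lemma vintegral_iter_tree_mx (v k i : 'I_n) : i = depth_rank t r v :> nat ->
  vintegral 0 1 (fun s => iter k (mulmx (tree_mx t r s)) (root_cv R r)) v 0 =
  sparse_hilbert_mx R n (max_depth t r) (ell t r) i k.
Proof.
move=> Ei; rewrite (sparse_hilbert_mx_depth_rank tree R k Ei) mxE.
under eq_Rintegral do rewrite (iter_tree_mx_root tree).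
case: ifP => _; first by rewrite Rintegral_cst // mul0r.
exact: Rintegral_exprn.
Qed.

(** The matrix of moments is the sparse Hilbert matrix with its rows permuted
by the depth ordering. *)
Lemma tree_moments_independent (p : 'rV[R]_n) :
  sparse_hilbert_mx R n (max_depth t r) (ell t r) \in unitmx ->
  (forall k, (k < n)%N ->
    p *m vintegral 0 1
      (fun s => iter k (mulmx (tree_mx t r s)) (root_cv R r)) = 0) ->
  p = 0.
Proof.
set H := sparse_hilbert_mx _ _ _ _ => unitH pc0.
pose pos v := Ordinal (depth_rank_lt t r v).
have pos_inj : injective pos.
  move=> u v [E]; apply: rank_inj E; exact: depth_key_inj.
pose p' : 'rV[R]_n := \row_i p 0 (invF pos_inj i).
have p'E v : p' 0 (pos v) = p 0 v by rewrite mxE invF_f.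
have p'H : p' *m H = 0.
  apply/rowP => k; rewrite mxE (reindex_inj pos_inj) /= [RHS]mxE.
  have /(congr1 (fun M : 'M[R]_1 => M 0 0)) := pc0 k (ltn_ord k).
  rewrite [RHS]mxE [LHS]mxE => pck; rewrite -[RHS]pck; apply: eq_bigr => v _.
  by rewrite p'E (@vintegral_iter_tree_mx v k (pos v)).
apply/rowP => v; rewrite -p'E.
by rewrite -(mulmxK unitH p') p'H mul0mx !mxE.
Qed.

End TreeEnsemble.

Theorem theorem2p11 (R : realType) (n : nat) (hn : (1 < n)%N)
    (G : sparsity_pattern n 1) (a1 : 'I_n) (ha1 : nat_of_ord a1 = 0%N)
    (hloop : G (inl a1) (inl a1)) (hbeta : G (inr ord0) (inl a1))
    (t : rel 'I_n) (ht : directed_spanning_tree (alpha_graph G) t a1)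
    (hH : (sparse_hilbert_mx R n (max_depth t a1) (ell t a1) \in unitmx)%R) :
  structurally_averaged_controllable R G.
Proof.
case: ht => sub_t tree.
exists (tree_mx t a1), (fun=> root_cv R a1); split.
  split.
  - exact: continuous_tree_mx.
  - by move=> s; exact: cvg_cst.
  - move=> i j not_ij s _; rewrite mxE.
    case: ifP => [/andP[/eqP ja1 /eqP ia1]|_].
      by rewrite ia1 ja1 hloop in not_ij.
    by case: ifP => // /sub_t ij; rewrite /alpha_graph (negPf not_ij) in ij.
  - move=> i j not_ij s _; rewrite mxE (ord1 i) eqxx andbT.
    by case: eqVneq => // ja1; rewrite (ord1 i) ja1 hbeta in not_ij.
apply: (@averaged_controllable_moments R n n).
- exact: continuous_tree_mx.
- by move=> s; exact: cvg_cst.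
- by move=> s x _; exact: iter_tree_mx_geometric.
- by move=> p; exact: tree_moments_independent.
Qed.
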